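(* Let $\mathbb F_q$ be a finite field and suppose $B \subseteq \mathbb F_q^m$ is $C$-weakly Sidorenko, with $p := \omega^\to(B) \geq 1$. Then, as $t \to \infty$, \[R_q(2,t) = O\big(t\, C^{t/p}\big),\] where the implied constant may depend on $B$, $C$ and $q$.
   Context: An affine relation on $x_1,\ldots,x_k$ is an equation $\sum_i \lambda_i x_i = 0$ with $\lambda_i \in \mathbb F_q$, $\sum_i \lambda_i = 0$; a set is affinely independent if it has no such relation with some $\lambda_i \neq 0$, and $\mathrm{rank}_{\mathrm{aff}}(B)$ is the size of a maximal affinely independent subset of $B$. For $B \subseteq \mathbb F_q^m$, $A \subseteq \mathbb F_q^n$, an affine homomorphism $B \to A$ is a map extending to an affine map $\mathbb F_q^m \to \mathbb F_q^n$; $\mathrm{hom}_{\mathrm{aff}}(B,A)$ is their number. $B$ is $C$-weakly Sidorenko if for every $n$ and every $A \subseteq \mathbb F_q^n$ with $|A| = \alpha q^n$, $\mathrm{hom}_{\mathrm{aff}}(B,A) \geq \alpha^C (q^n)^{\mathrm{rank}_{\mathrm{aff}}(B)}$. The direction set of $B$ is $B^\to := \{d \in \mathbb F_q^m : \exists x \text{ with } x + \lambda d \in B \text{ for all } \lambda \in \mathbb F_q\}$, and $\omega^\to(B)$ is the largest dimension of a linear subspace contained in $B^\to \cup \{0\}$. $R_q(2,t)$ is the minimum $n$ such that for every red-blue coloring of the $1$-dimensional linear subspaces of $\mathbb F_q^n$, there is either a $2$-dimensional linear subspace all of whose $1$-dimensional subspaces are red, or a $t$-dimensional linear subspace all of whose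 $1$-dimensional subspaces are blue. *)

(* Defs.v *)
From HB Require Import structures.
From mathcomp Require Import all_boot all_order all_algebra.
From mathcomp Require Import boolp reals exp.
Set Implicit Arguments. Unset Strict Implicit. Unset Printing Implicit Defensive.
Import Order.TTheory GRing.Theory Num.Theory.
Local Open Scope ring_scope.

Section AffineDefs.
Variable F : finFieldType.

Definition aff_indep (m : nat) (S : {set 'rV[F]_m}) : bool :=
  [forall lam : {ffun 'rV[F]_m -> F},
     ((\sum_(x in S) lam x == 0) && (\sum_(x in S) lam x *: x == 0))
       ==> [forall x in S, lam x == 0]].

(* rank_aff B : size of a maximal (= maximum, by the matroid property)
   affinely independent subset of B. *)
Definition rank_aff (m : nat) (B : {set 'rV[F]_m}) : nat :=
  \max_(S : {set 'rV[F]_m} | (S \subset B) && aff_indep S) #|S|.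

(* hom_aff B A : number of maps B -> A that extend to an affine map
   F^m -> F^n (x |-> x *m M + b).  A map on B is encoded by the finite
   function equal to it on B and to 0 outside B. *)
Definition hom_aff (m n : nat) (B : {set 'rV[F]_m}) (A : {set 'rV[F]_n}) : nat :=
  #|[set g : {ffun 'rV[F]_m -> 'rV[F]_n} |
      [exists M : 'M[F]_(m, n), exists b : 'rV[F]_n,
         [forall x, g x == (if x \in B then x *m M + b else 0)]]
      && [forall x in B, g x \in A]]|.

Definition weakly_sidorenko (R : realType) (m : nat) (B : {set 'rV[F]_m}) (C : R)
  : Prop :=
  forall (n : nat) (A : {set 'rV[F]_n}),
    powR (#|A|%:R / (#|F| ^ n)%:R) C * ((#|F| ^ n)%:R ^+ rank_aff B)
      <= (hom_aff B A)%:R.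

Definition dirset (m : nat) (B : {set 'rV[F]_m}) : {set 'rV[F]_m} :=
  [set d | [exists x : 'rV[F]_m, [forall l : F, x + l *: d \in B]]].

Definition omega_dir (m : nat) (B : {set 'rV[F]_m}) : nat :=
  \max_(S : 'M[F]_m |
          [forall v : 'rV[F]_m, (v <= S)%MS ==> ((v == 0) || (v \in dirset B))])
     \rank S.

(* Ramsey property for R_q(2,t) in dimension n.  One-dimensional subspaces
   of F^n are represented canonically as <<v>>%MS for v != 0; a red/blue
   colouring is given by its set Red of red lines (all other lines blue).
   Linear subspaces are row spaces of square matrices S, dimension \rank S. *)
Definition ramsey_prop (t n : nat) : bool :=
  [forall Red : {set 'M[F]_n},
     [exists S : 'M[F]_n, (\rank S == 2%N) &&
        [forall v : 'rV[F]_n, ((v != 0) && (v <= S)%MS) ==> (<<v>>%MS \in Red)]]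
  || [exists S : 'M[F]_n, (\rank S == t) &&
        [forall v : 'rV[F]_n, ((v != 0) && (v <= S)%MS) ==> (<<v>>%MS \notin Red)]]].

(* R_q(2,t) : the least n with the Ramsey property (it exists by the
   finite-field Ramsey theorem; the default 0 is never used). *)
Definition Rq2 (t : nat) : nat :=
  match pselect (exists n, ramsey_prop t n) with
  | left h => ex_minn h
  | right _ => 0%N
  end.

End AffineDefs.

(* Main.v *)
(* If [b] and [d] are such that the whole affine line [b + l d] consists of
   vectors spanning red lines and [d] is also red, then the plane spanned by [b]
   and [d] is red.  So without red planes, every nonzero direction of the set
   [A0] of red vectors is blue; and without blue [t]-spaces, [A0] meets each
   nonzero coset of a maximal blue subspace, hence has density at least [q^-t].

   Let [U] be a [p]-dimensional space of directions of [B].  Given [A] of density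
   [q^-a], pigeonholing the affine homomorphisms [B -> A] over their linear parts
   yields [M], injective on [U] modulo any prescribed small [W], such that the
   set [A'] of translations [b] with [B M + b] inside [A] has density at least
   [q^-(C a + 1)].  If [d] is a direction of [A'], then all of [d + U M] are
   directions of [A].  Iterating [k = t / p + 1] times from [A0] gives a blue
   space of dimension [p k >= t], and the only constraint on the dimension [n]
   is that it exceeds about [C^k (t + k)]. *)
Require Import Defs.
From HB Require Import structures.
From mathcomp Require Import all_boot all_order all_algebra mxabelem.
From mathcomp Require Import boolp reals exp.
From mathcomp Require Import zify ring lra.
Import Order.TTheory GRing.Theory Num.Theory.
Local Open Scope ring_scope.
Set Implicit Arguments. Unset Strict Implicit. Unset Printing Implicit Defensive.

(** * Affine frames and counting affine homomorphisms *)

(** Take for [Q] a maximal free family among the differences [x - x0]. The points it comes from,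
    together with [x0], are affinely independent, since subtracting [x0] turns an affine relation
    into a linear one between rows of [Q]. *)
Lemma rank_aff_frame (F : finFieldType) (m : nat) (B : {set 'rV[F]_m})
  (x0 : 'rV[F]_m) :
  x0 \in B ->
  exists (d : nat) (Q : 'M[F]_(d, m)),
    [/\ row_free Q, forall x, x \in B -> (x - x0 <= Q)%MS & (d < rank_aff B)%N].
Proof.
move=> Bx0.
pose X : 'M[F]_(#|B|, m) := \matrix_i (enum_val i - x0).
pose f := maxrankfun X; pose Q := rowsub f X.
pose y i := enum_val (f i) : 'rV[F]_m.
have QE i : row i Q = y i - x0 by rewrite /Q row_rowsub rowK.
have Qfree : row_free Q := maxrowsub_free X.
exists (\rank X), Q; split=> // [x Bx|].
  rewrite eq_maxrowsub; have <- : row (enum_rank_in Bx x) X = x - x0.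
    by rewrite rowK enum_rankK_in.
  exact: row_sub.
have yx0 i : y i != x0.
  rewrite -subr_eq0 -QE; apply: contraL Qfree => /eqP Qi0.
  apply/negP => Qfree.
  have : (delta_mx 0 i : 'rV_(\rank X)) *m Q = 0 *m Q by rewrite -rowE Qi0 mul0mx.
  move/(row_free_inj Qfree)/matrixP/(_ 0 i)/eqP.
  by rewrite !mxE !eqxx oner_eq0.
have yI : injective y.
  by move=> i j /enum_val_inj; apply: maxrankfun_inj.
have x0N : x0 \notin [set y i | i : 'I_(\rank X)].
  by apply/imsetP => -[i _ /eqP]; rewrite eq_sym (negPf (yx0 i)).
pose S := x0 |: [set y i | i : 'I_(\rank X)].
have cardS : #|S| = (\rank X).+1 by rewrite cardsU1 x0N card_imset // card_ord.
rewrite -cardS /rank_aff; apply: leq_bigmax_cond; apply/andP; split.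
  rewrite subUset sub1set Bx0; apply/subsetP => _ /imsetP[i _ ->].
  exact: enum_valP.
apply/forallP => lam; apply/implyP => /andP[/eqP s0 /eqP s1].
have : \sum_(x in S) lam x *: (x - x0) = 0.
  under eq_bigr do rewrite scalerBr.
  by rewrite sumrB s1 -scaler_suml s0 scale0r subrr.
rewrite big_setU1 //= subrr scaler0 add0r big_imset /=; last first.
  by move=> i j _ _; apply: yI.
move=> s2.
have lam0 i : lam (y i) = 0.
  have : (\row_j lam (y j)) *m Q = 0 *m Q.
    rewrite mul0mx mulmx_sum_row -[RHS]s2; apply: eq_bigr => j _.
    by rewrite QE mxE.
  by move/(row_free_inj Qfree)/matrixP/(_ 0 i); rewrite !mxE.
move: s0; rewrite big_setU1 //= big_imset /=; last by move=> i j _ _; apply: yI.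
rewrite big1 ?addr0 => [lamx0|i _]; last exact: lam0.
by apply/forall_inP => x /setU1P[->|/imsetP[i _ ->]]; rewrite ?lamx0 ?lam0.
Qed.

(** If [c] is nonzero at [i], then [Y] is recovered from [c *m Y] and its rows other than [i]. The
    factor [#|F| ^ n] on the left avoids the exponent [d - 1]. *)
Lemma card_mulmx_sub (F : finFieldType) (d n : nat) (c : 'rV[F]_d) (W : 'M[F]_n) :
  c != 0 ->
  (#|[set Y : 'M[F]_(d, n) | (c *m Y <= W)%MS]| * #|F| ^ n
     <= #|F| ^ \rank W * (#|F| ^ n) ^ d)%N.
Proof.
case: d c => [|d] c; first by rewrite thinmx0 eqxx.
case/rV0Pn => i ci.
pose h (Y : 'M[F]_(d.+1, n)) := (c *m Y, row' i Y).
have hI : injective h.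
  move=> Y Z [eqc eqr]; apply/row_matrixP => k.
  have rowE' j : row (lift i j) Y = row (lift i j) Z.
    by apply/rowP => l; move/matrixP/(_ j l): eqr; rewrite !mxE.
  case: (unliftP i k) => [j ->|->]; first exact: rowE'.
  move: eqc; rewrite !mulmx_sum_row !(bigD1_ord i) //=.
  under eq_bigr do rewrite rowE'.
  by move/addIr/(scalerI ci).
set L := [set Y | _].
have : (#|L| <= #|setX (rowg W) [set: 'M[F]_(d, n)]|)%N.
  rewrite -(card_imset _ hI) subset_leq_card //; apply/subsetP => _ /imsetP[Y + ->].
  by rewrite !inE /= andbT => ->.
rewrite cardsX card_rowg cardsT card_mx => cardL.
by rewrite expnS mulnCA mulnC leq_mul2l [(_ * (_ ^ n) ^ _)%N]mulnC -expnM mulnC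
  (mulnC n) cardL orbT.
Qed.

Lemma leq_card_bigcup (I T : finType) (P : pred I) (G : I -> {set T}) :
  (#|\bigcup_(i | P i) G i| <= \sum_(i | P i) #|G i|)%N.
Proof.
elim/big_rec2: _ => [|i k A _ le]; first by rewrite cards0.
by apply: leq_trans (leq_card_setU _ _) _; rewrite leq_add2l.
Qed.

(** Union bound over the nonzero [u] in [U]. Here [Y] gives the images of the rows of [Q], and
    [pinvmx Q *m Y] is a linear map on the whole space with these values. *)
Lemma card_noninjective (F : finFieldType) (m d n : nat) (Q : 'M[F]_(d, m))
  (U : 'M[F]_m) (W : 'M[F]_n) :
  (U <= Q)%MS ->
  (#|[set Y : 'M[F]_(d, n) | [exists u : 'rV[F]_m,
        [&& (u != 0)%R, (u <= U)%MS & (u *m (pinvmx Q *m Y) <= W)%MS]]]| * #|F| ^ n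
     <= #|F| ^ (\rank U + \rank W) * (#|F| ^ n) ^ d)%N.
Proof.
move=> UQ; set L := [set Y | _].
pose G (u : 'rV[F]_m) := [set Y : 'M[F]_(d, n) | ((u *m pinvmx Q) *m Y <= W)%MS].
have LG : L \subset \bigcup_(u in rowg U :\ 0) G u.
  apply/subsetP => Y; rewrite inE => /existsP[u /and3P[u0 uU uW]].
  by apply/bigcupP; exists u; rewrite !inE; [apply/andP | rewrite -mulmxA].
have := leq_trans (subset_leq_card LG) (leq_card_bigcup _ _) => cardL.
apply: leq_trans (leq_mul cardL (leqnn _)) _; rewrite big_distrl /=.
apply: (@leq_trans (\sum_(u in rowg U :\ 0) #|F| ^ \rank W * (#|F| ^ n) ^ d)).
  apply: leq_sum => u; rewrite !inE => /andP[u0 uU].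
  apply: card_mulmx_sub; apply: contraNneq u0 => uQ0.
  by rewrite -(mulmxKpV (submx_trans uU UQ)) uQ0 mul0mx.
rewrite sum_nat_const expnD -mulnA leq_mul2r.
by rewrite -[(_ ^ \rank U)%N]card_rowg subset_leq_card ?subsetDl ?orbT.
Qed.

(* The affine maps with linear part [M] sending [B] into [A], each encoded by the
   image of the base point [x0]. *)
Definition translates (F : finFieldType) (m n : nat) (B : {set 'rV[F]_m})
  (x0 : 'rV[F]_m) (A : {set 'rV[F]_n}) (M : 'M[F]_(m, n)) : {set 'rV[F]_n} :=
  [set b | [forall x in B, (x - x0) *m M + b \in A]].

(** On [B], the map [x *m M + b] depends only on [Y = Q *m M] and on the image [x0 *m M + b] of the
    base point. *)
Lemma hom_aff_le_sum (F : finFieldType) (m d n : nat) (B : {set 'rV[F]_m})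
  (A : {set 'rV[F]_n}) (x0 : 'rV[F]_m) (Q : 'M[F]_(d, m)) :
  (forall x, x \in B -> (x - x0 <= Q)%MS) ->
  (hom_aff B A
     <= \sum_(Y : 'M[F]_(d, n)) #|translates B x0 A (pinvmx Q *m Y)|)%N.
Proof.
move=> BQ.
pose G (Y : 'M[F]_(d, n)) := translates B x0 A (pinvmx Q *m Y).
pose h (Y : 'M[F]_(d, n)) (b : 'rV[F]_n) : {ffun 'rV[F]_m -> 'rV[F]_n} :=
  [ffun x => if x \in B then (x - x0) *m (pinvmx Q *m Y) + b else 0].
apply: (@leq_trans #|\bigcup_Y [set h Y b | b in G Y]|); last first.
  apply: leq_trans (leq_card_bigcup _ _) _.
  by apply: leq_sum => Y _; apply: leq_imset_card.
apply: subset_leq_card; apply/subsetP => g; rewrite inE.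
case/andP => /existsP[M /existsP[b /forallP gE]] gA.
have gB x : x \in B -> g x = (x - x0) *m (pinvmx Q *m (Q *m M)) + (x0 *m M + b).
  move=> Bx; have /eqP-> := gE x; rewrite Bx.
  have := mulmxKpV (BQ x Bx); move: (pinvmx Q) => P PE; rewrite !mulmxA PE.
  by rewrite mulmxBl addrA subrK.
apply/bigcupP; exists (Q *m M) => //; apply/imsetP; exists (x0 *m M + b).
  by rewrite inE; apply/forall_inP => x Bx; rewrite -gB // (forall_inP gA).
apply/ffunP => x; rewrite ffunE; case: ifP => Bx; first exact: gB.
by have /eqP-> := gE x; rewrite Bx.
Qed.

Lemma translates_dense (F : finFieldType) (R : realType) (m n : nat) (B : {set 'rV[F]_m})
  (x0 : 'rV[F]_m) (C a : R) (U : 'M[F]_m) (A : {set 'rV[F]_n}) (W : 'M[F]_n) :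
  weakly_sidorenko B C -> 0 <= C -> x0 \in B ->
  (forall u : 'rV[F]_m, (u <= U)%MS -> u \in dirset B) ->
  powR #|F|%:R (n%:R - a) <= #|A|%:R ->
  (\rank U + \rank W)%:R + C * a + 2 <= n%:R ->
  exists M : 'M[F]_(m, n),
    (forall u : 'rV[F]_m, (u <= U)%MS -> (u *m M <= W)%MS -> u = 0) /\
    powR #|F|%:R (n%:R - (C * a + 1)) <= #|translates B x0 A M|%:R.
Proof.
move=> sidB C0 Bx0 Udir dA le_n.
have [d [Q [Qfree BQ dB]]] := rank_aff_frame Bx0.
have UQ : (U <= Q)%MS.
  apply/rV_subP => u /Udir; rewrite inE => /existsP[x /forallP xB].
  have -> : u = (x + 1 *: u - x0) - (x + 0 *: u - x0).
    by rewrite scale0r scale1r addr0 opprB addrA subrK [x + u]addrC addrK.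
  by apply: addmx_sub; rewrite ?eqmx_opp; apply: BQ.
set q : R := #|F|%:R in dA *.
have q2 : 2 <= q by rewrite ler_nat card_finNzRing_gt1.
have q0 : 0 < q by lra.
have powD x y : powR q (x + y) = powR q x * powR q y.
  by rewrite powRD // (gt_eqF q0) implybT.
set N : R := powR q n%:R.
have NE : (#|F| ^ n)%:R = N by rewrite natrX /N powR_mulrn // ltW.
have N1 : 1 <= N by rewrite -NE ler1n expn_gt0 (ltn_trans _ (card_finNzRing_gt1 _)).
pose e := powR q (- (C * a)).
have e0 : 0 < e by apply: powR_gt0.
(* The density of [A] is at least [q ^ (- a)], and [d.+1] is at most the affine rank of [B]. *)
have homL : e * N ^+ d.+1 <= (hom_aff B A)%:R.
  apply: le_trans (sidB n A); rewrite NE.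
  apply: ler_pM; [exact: ltW | by rewrite exprn_ge0 //; lra | | exact: ler_weXn2l].
  rewrite /e mulrC -mulNr powRrM; apply: ge0_ler_powR => //.
  - by rewrite nnegrE ltW ?powR_gt0.
  - by rewrite nnegrE divr_ge0 //; lra.
  - rewrite ler_pdivlMr; last by lra.
    by rewrite /N -powD addrC.
apply: contrapT => noM.
pose T (Y : 'M[F]_(d, n)) := translates B x0 A (pinvmx Q *m Y).
pose bad := [set Y : 'M[F]_(d, n) | [exists u : 'rV[F]_m,
        [&& u != 0, (u <= U)%MS & (u *m (pinvmx Q *m Y) <= W)%MS]]].
have cardV : #|[set: 'rV[F]_n]| = (#|F| ^ n)%N by rewrite cardsT card_mx mul1n.
have TN (Y : 'M[F]_(d, n)) : #|T Y|%:R <= N.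
  by rewrite -NE ler_nat -cardV subset_leq_card ?subsetT.
have Tgood Y : Y \notin bad -> #|T Y|%:R <= N * (e / q).
  move=> gY; rewrite leNgt; apply/negP => lt; apply: noM.
  exists (pinvmx Q *m Y); split=> [u uU uW|].
    by apply: contraNeq gY => u0; rewrite inE; apply/existsP; exists u; rewrite u0 uU.
  by apply: ltW; rewrite opprD addrA !powD powR_inv1 ?(ltW q0) // -mulrA.
have badN : #|bad|%:R * N <= powR q (\rank U + \rank W)%:R * N ^+ d.
  have := @card_noninjective F m d n Q U W UQ; rewrite -/bad -(ler_nat R) !natrM !NE.
  by rewrite (natrX _ (_ ^ n)%N) NE natrX -/q powR_mulrn // ltW.
(* The summand 2 in the bound on [n] is spent here: it limits the share of the bad [Y] to
   [q ^ (- 2)] of the main term. *)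
have powle : powR q (\rank U + \rank W)%:R <= N * (e / q) / q.
  have -> : N * (e / q) / q = powR q (n%:R - C * a - 1 - 1).
    by rewrite !powD powR_inv1 ?(ltW q0) // !mulrA.
  by apply: ler_powR; lra.
have homU : (hom_aff B A)%:R <= #|bad|%:R * N + N ^+ d * (N * (e / q)).
  have := @hom_aff_le_sum F m d n B A x0 Q BQ; rewrite -(ler_nat R) natr_sum => h.
  apply: (le_trans h); rewrite (bigID (mem bad)) /=; apply: lerD.
    rewrite -sum1_card natr_sum mulr_suml; apply: ler_sum => Y _.
    by rewrite mul1r TN.
  apply: le_trans (ler_sum _ (fun Y => Tgood Y)) _.
  rewrite sumr_const -mulr_natl; apply: ler_wpM2r.
    by rewrite mulr_ge0 ?divr_ge0 //; lra.
  rewrite -NE -natrX ler_nat -expnM mulnC -card_mx.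
  exact: max_card.
have Nd0 : 0 < N ^+ d by rewrite exprn_gt0 //; lra.
(* Bad and good [Y] together contribute at most a fraction [1/q^2 + 1/q <= 3/4] of what the lower
   bound requires. *)
have : e * N ^+ d.+1 <= N ^+ d * N * e * (q^-1 * q^-1 + q^-1).
  apply: le_trans homL (le_trans homU _).
  apply: le_trans (lerD badN (lexx _)) _.
  apply: le_trans (lerD (ler_wpM2r (ltW Nd0) powle) (lexx _)) _.
  by rewrite le_eqVlt; apply/orP; left; apply/eqP; ring.
have qi : q^-1 <= 2^-1 by rewrite lef_pV2 ?posrE.
have qi0 : 0 < q^-1 by rewrite invr_gt0.
have pos : 0 < N ^+ d * N * e by rewrite !mulr_gt0 //; lra.
have -> : e * N ^+ d.+1 = N ^+ d * N * e by rewrite exprSr mulrC.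
by rewrite ler_pMr //; nra.
Qed.

(** * Red vectors and blue subspaces of a colouring *)

Lemma exists_submx_rank (F : fieldType) (n t : nat) (S : 'M[F]_n) :
  (t <= \rank S)%N -> exists2 S' : 'M[F]_n, \rank S' = t & (S' <= S)%MS.
Proof.
move=> tS; exists ((pid_mx t : 'M_(n, _)) *m row_base S).
  rewrite mxrankMfree ?row_base_free // rank_pid_mx //.
  exact: leq_trans tS (rank_leq_row _).
by apply: submx_trans (submxMl _ _) _; rewrite eq_row_base.
Qed.

Lemma genmx_scale (F : fieldType) (n : nat) (c : F) (v : 'rV[F]_n) :
  c != 0 -> <<c *: v>>%MS = <<v>>%MS.
Proof. by move=> c0; apply: eq_genmx; apply: eqmx_scale. Qed.

Definition red_vectors (F : finFieldType) (n : nat) (Red : {set 'M[F]_n}) : {set 'rV[F]_n} :=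
  [set v | (v != 0) && (<<v>>%MS \in Red)].

Lemma red_vectors_direction (F : finFieldType) (n : nat) (Red : {set 'M[F]_n}) (b d : 'rV[F]_n) :
  (forall S : 'M[F]_n, \rank S = 2%N ->
     exists v : 'rV[F]_n, [/\ v != 0, (v <= S)%MS & <<v>>%MS \notin Red]) ->
  (forall l : F, b + l *: d \in red_vectors Red) -> d != 0 -> <<d>>%MS \notin Red.
Proof.
move=> noplane bd d0; apply/negP => dR.
(* Red vectors are nonzero, so the line [b + l *: d] misses the origin. *)
have bNd : ~~ (b <= d)%MS.
  apply/sub_rVP => -[c bE]; have := bd (- c).
  by rewrite inE bE scaleNr subrr eqxx.
have rk : \rank (d + b)%MS = 2%N.
  rewrite mxrank_disjoint_sum ?rank_rV ?d0.
    case: eqP => // b0; by rewrite b0 sub0mx in bNd.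
  apply/eqP; rewrite -submx0; apply/rV_subP => v.
  rewrite sub_capmx => /andP[/sub_rVP[x ->] /sub_rVP[y xy]].
  have [y0|y0] := eqVneq y 0; first by rewrite xy y0 scale0r sub0mx.
  case/negP: bNd; apply/sub_rVP; exists (y^-1 * x).
  by rewrite -scalerA xy scalerA mulVf // scale1r.
have [v [v0 /sub_addsmxP[[x y] /= vE]]] := noplane _ rk.
rewrite [x]mx11_scalar [y]mx11_scalar !mul_scalar_mx in vE.
apply/negP; rewrite negbK vE; have [y0|y0] := eqVneq (y 0 0) 0.
  rewrite y0 scale0r addr0 genmx_scale //; apply: contraNneq v0 => x0.
  by rewrite vE y0 x0 !scale0r addr0.
have -> : x 0 0 *: d + y 0 0 *: b = y 0 0 *: (b + (x 0 0 / y 0 0) *: d).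
  by rewrite scalerDr scalerA mulrC divfK // addrC.
by rewrite genmx_scale //; have := bd (x 0 0 / y 0 0); rewrite inE => /andP[].
Qed.

Lemma red_vectors_dense (F : finFieldType) (n t : nat) (Red : {set 'M[F]_n}) :
  (forall S : 'M[F]_n, \rank S = t ->
     exists v : 'rV[F]_n, [/\ v != 0, (v <= S)%MS & <<v>>%MS \in Red]) ->
  (t <= n)%N -> (#|F| ^ (n - t) <= #|red_vectors Red|)%N.
Proof.
move=> noblue tn.
pose blue (S : 'M[F]_n) :=
  [forall v : 'rV[F]_n, ((v != 0) && (v <= S)%MS) ==> (<<v>>%MS \notin Red)].
have blue0 : blue 0.
  by apply/forallP => v; rewrite submx0; case: eqP.
case: (@arg_maxnP _ (0 : 'M[F]_n) blue (fun S => \rank S) blue0) => W Wblue Wmax.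
have Wt : (\rank W < t)%N.
  rewrite ltnNge; apply/negP => /exists_submx_rank[S rS SW].
  have [v [v0 vS vR]] := noblue S rS.
  by have /forallP/(_ v) := Wblue; rewrite v0 (submx_trans vS SW) vR.
(* By maximality [W + v] contains a red vector. Its coefficient on [v] is nonzero because [W] is
   blue, so it can be rescaled to 1. *)
have hit v : ~~ (v <= W)%MS -> exists2 w, (w <= W)%MS & v + w \in red_vectors Red.
  move=> vW; have /forallPn[y] : ~~ blue (W + v)%MS.
    apply/negP => /Wmax; apply/negP; rewrite -ltnNge.
    apply: rank_ltmx.
    by rewrite /ltmx addsmxSl addsmx_sub negb_and vW orbT.
  rewrite negb_imply negbK => /andP[/andP[y0 /sub_addsmxP[[x z] /= yE]] yR].
  rewrite [z]mx11_scalar mul_scalar_mx in yE; set c := z 0 0 in yE.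
  have c0 : c != 0.
    apply: contraTneq yR => c0; move: yE; rewrite c0 scale0r addr0 => yE.
    by have /forallP/(_ y) := Wblue; rewrite y0 {1}yE submxMl.
  exists (c^-1 *: (x *m W)); first by rewrite scalemx_sub ?submxMl.
  have -> : v + c^-1 *: (x *m W) = c^-1 *: y.
    by rewrite yE scalerDr scalerA mulVf // scale1r addrC.
  by rewrite inE genmx_scale ?invr_eq0 // yR scaler_eq0 invr_eq0 (negPf c0) y0.
have capW : (W^C :&: W)%MS = 0 by rewrite capmxC capmx_compl.
(* Projecting along [W], the red vectors cover all nonzero vectors of a complement. There are at
   least [q ^ (n - t + 1) - 1] of these, and [q >= 2] absorbs the [- 1]. *)
have sub : rowg W^C%MS :\ 0 \subset [set x *m proj_mx W^C%MS W | x in red_vectors Red].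
  apply/subsetP => v; rewrite !inE => /andP[v0 vC].
  have [|w wW vw] := hit v.
    apply: contra v0 => vW; rewrite -submx0 -capW.
    by rewrite sub_capmx; apply/andP.
  by apply/imsetP; exists (v + w); rewrite // mulmxDl proj_mx_id // proj_mx_0 // addr0.
have := leq_trans (subset_leq_card sub) (leq_imset_card _ _).
have := cardsD1 0 (rowg W^C%MS); rewrite inE sub0mx card_rowg mxrank_compl => cC le.
have : (#|F| * #|F| ^ (n - t) <= #|F| ^ (n - \rank W))%N.
  by rewrite -expnS leq_pexp2l //; [exact: ltnW (card_finNzRing_gt1 _) | lia].
have := card_finNzRing_gt1 F.
have : (0 < #|F| ^ (n - t))%N by rewrite expn_gt0 (ltnW (card_finNzRing_gt1 _)).
rewrite cC /= => X0 q2 qX; have := leq_trans (leq_mul q2 (leqnn _)) qX.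
move: X0 le; rewrite add1n mul2n -addnn.
set x := (_ ^ (n - t))%N; set r := #|red_vectors _|; set c := #|_|; lia.
Qed.

(** * Iterating the passage to translates *)

(** Test the definition on a single point of the line: there is at most one homomorphism, while the
    affine rank is at least 1, so [q <= q ^ C]. *)
Lemma weakly_sidorenko_ge1 (F : finFieldType) (R : realType) (m : nat)
  (B : {set 'rV[F]_m}) (C : R) :
  weakly_sidorenko B C -> B != set0 -> 1 <= C.
Proof.
move=> sidB /set0Pn[x0 Bx0].
have [d [Q [_ _ dB]]] := rank_aff_frame Bx0.
have := sidB 1%N [set 0]; rewrite cards1 expn1 div1r.
set q : R := #|F|%:R.
have q2 : 2 <= q by rewrite ler_nat card_finNzRing_gt1.
have q0 : 0 < q by lra.
have hom1 : (hom_aff B [set 0%R : 'rV[F]_1] <= 1)%N.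
  rewrite -[X in (_ <= X)%N](cards1 ([ffun => 0] : {ffun 'rV[F]_m -> 'rV[F]_1})).
  apply/subset_leq_card/subsetP => g; rewrite !inE.
  case/andP => /existsP[M /existsP[b /forallP gE]] /forall_inP g0.
  apply/eqP/ffunP => x; rewrite ffunE; have [Bx|Bx] := boolP (x \in B).
    by have := g0 x Bx; rewrite inE => /eqP.
  by have /eqP-> := gE x; rewrite (negPf Bx).
move=> le; have {le} : powR q^-1 C * q ^+ rank_aff B <= 1.
  by apply: le_trans le _; rewrite -[1]/(1%:R) ler_nat.
rewrite -powR_inv1 ?(ltW q0) // -powRrM mulN1r powRN mulrC ler_pdivrMr ?powR_gt0 //.
rewrite mul1r; move: (rank_aff B) (leq_ltn_trans (leq0n d) dB) => r r0 le.
rewrite leNgt; apply/negP => C1.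
have : q <= q ^+ r by apply: ler_eXnr => //; lra.
move=> /le_trans/(_ le) qC.
have : powR q (1 - C) == 1.
  rewrite eq_le -[X in _ && (X <= _)](powRr0 q) ler_powR; [|lra|lra].
  rewrite powRD; last by rewrite (gt_eqF q0) implybT.
  by rewrite powRr1 ?(ltW q0) // powRN ler_pdivrMr ?powR_gt0 // mul1r qC.
rewrite powR_eq1; lra.
Qed.

(** Induction on [k]. One step turns a density loss [a] into [C * a + 1], and [C ^+ k * (t + k)]
    dominates the resulting recursion because [C >= 1]. The last clause allows [d = 0], which makes
    every vector of [W] a direction of [A0] once [A] has a point. *)
Lemma iterated_translates (F : finFieldType) (R : realType) (m n t k : nat)
  (B : {set 'rV[F]_m}) (C : R) (U : 'M[F]_m) (A0 : {set 'rV[F]_n}) :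
  weakly_sidorenko B C -> 1 <= C -> B != set0 ->
  (forall u : 'rV[F]_m, (u <= U)%MS -> u \in dirset B) ->
  (#|F| ^ (n - t) <= #|A0|)%N -> 
  (\rank U * k)%:R + 1 + C ^+ k * (t + k)%:R <= n%:R ->
  exists (A : {set 'rV[F]_n}) (W : 'M[F]_n),
    [/\ \rank W = (\rank U * k)%N,
        powR #|F|%:R (n%:R - C ^+ k * (t + k)%:R) <= #|A|%:R :> R &
        forall b d : 'rV[F]_n, (forall l : F, b + l *: d \in A) ->
        forall w : 'rV[F]_n, (w <= W)%MS ->
        exists b' : 'rV[F]_n, forall l : F, b' + l *: (d + w) \in A0].
Proof.
move=> sidB C1 /set0Pn[x0 Bx0] Udir A0dense.
have q1 : 1 <= #|F|%:R :> R by rewrite ler1n ltnW ?card_finNzRing_gt1.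
elim: k => [|k IH] le_n.
  exists A0, 0; split; first by rewrite mxrank0 muln0.
    rewrite expr0 mul1r addn0; apply: le_trans (_ : (#|F| ^ (n - t))%:R <= _).
      rewrite natrX -powR_mulrn; last lra.
      by apply: ler_powR => //; rewrite lerBlDr -natrD ler_nat; lia.
    by rewrite ler_nat.
  by move=> b d bd w; rewrite submx0 => /eqP->; exists b => l; rewrite addr0.
have Ck1 : 1 <= C ^+ k by apply: exprn_ege1.
have CkC : C ^+ k <= C ^+ k.+1 by rewrite exprS ler_peMl //; lra.
have stepE : C * (C ^+ k * (t + k)%:R) + 1 <= C ^+ k.+1 * (t + k.+1)%:R.
  rewrite addnS -natr1 mulrDr mulr1 exprS mulrA lerD2l -exprS; lra.
have tk0 : 0 <= (t + k)%:R :> R by [].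
have stepm : C ^+ k * (t + k)%:R <= C * (C ^+ k * (t + k)%:R).
  by rewrite ler_peMl // mulr_ge0 //; lra.
have pk : (\rank U * k.+1)%:R = (\rank U)%:R + (\rank U * k)%:R :> R.
  by rewrite mulnS natrD.
have p0 : 0 <= (\rank U)%:R :> R by [].
have [|A [W [rW dA dirA]]] := IH; first by lra.
have [||M [MI dM]] := @translates_dense F R m n B x0 C _ U A W sidB _ Bx0 Udir dA; first lra.
  by rewrite rW natrD; lra.
exists (translates B x0 A M), (W + U *m M)%MS; split.
(* Injectivity of [M] on [U] modulo [W] gives both that [U *m M] meets [W] trivially and that it has
   the rank of [U]. *)
- rewrite mxrank_disjoint_sum; last first.
    apply/eqP; rewrite -submx0; apply/rV_subP => v.
    rewrite sub_capmx => /andP[vW /submxP[c vE]].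
    rewrite vE mulmxA (MI (c *m U)) ?submxMl ?mul0mx ?sub0mx //.
    by rewrite -mulmxA -vE.
  rewrite rW mulnS addnC; congr (_ + _)%N; apply/mxrank_injP.
  rewrite -submx0; apply/rV_subP => v; rewrite sub_capmx => /andP[vU /sub_kermxP vM].
  by rewrite (MI v) ?sub0mx // vM sub0mx.
- by apply: le_trans dM; apply: ler_powR => //; lra.
move=> b d bd w' /sub_addsmxP[[c1 c2] /= ->].
have uU : (c2 *m U <= U)%MS by apply: submxMl.
have := Udir _ uU; rewrite inE => /existsP[x /forallP xB].
have -> : d + (c1 *m W + c2 *m (U *m M)) = d + c2 *m U *m M + c1 *m W.
  by rewrite [RHS]addrAC -addrA mulmxA.
(* Move along both lines at once: the point [x + l *: u] of [B], with [u = c2 *m U], under the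
   translation [b + l *: d], lands in [A]. *)
apply: (dirA ((x - x0) *m M + b)); last exact: submxMl.
move=> l; have := bd l; rewrite inE => /forall_inP/(_ _ (xB l)).
congr (_ \in A); rewrite !mulmxDl scalerDr -scalemxAl.
by rewrite -!addrA; congr (_ + _); rewrite addrC -!addrA.
Qed.

(** Positive dimension gives a nonzero direction, hence a point of [B]; the constant line at that
    point makes 0 a direction too. *)
Lemma omega_dir_witness (F : finFieldType) (m : nat) (B : {set 'rV[F]_m}) :
  (0 < omega_dir B)%N ->
  B != set0 /\ exists2 U : 'M[F]_m, \rank U = omega_dir B &
    forall u : 'rV[F]_m, (u <= U)%MS -> u \in dirset B.
Proof.
move=> p0.
have [U Udir rU] : exists2 U : 'M[F]_m,
    [forall v : 'rV[F]_m, (v <= U)%MS ==> ((v == 0) || (v \in dirset B))] &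
    \rank U = omega_dir B.
  have [|U Udir rU] := @eq_bigmax_cond _ [pred S : 'M[F]_m |
    [forall v : 'rV[F]_m, (v <= S)%MS ==> ((v == 0) || (v \in dirset B))]]
    (fun S => \rank S).
    apply/card_gt0P; exists 0; rewrite inE.
    by apply/forallP => v; rewrite submx0; case: eqP.
  by exists U; rewrite // /omega_dir rU.
have [x Bx] : exists x, x \in B.
  have /rowV0Pn[v vU v0] : U != 0 by rewrite -mxrank_eq0 rU -lt0n.
  have /forallP/(_ v) := Udir; rewrite vU (negPf v0) inE => /existsP[x /forallP/(_ 0)].
  by rewrite scale0r addr0; exists x.
split; first by apply/set0Pn; exists x.
exists U => // u uU; have /forallP/(_ u) := Udir; rewrite uU => /orP[/eqP->|//].
by rewrite inE; apply/existsP; exists x; apply/forallP => l; rewrite scaler0 addr0.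
Qed.

(** * The Ramsey property and the final estimate *)

Lemma ramsey_prop_of_dim (F : finFieldType) (R : realType) (m n t k : nat)
  (B : {set 'rV[F]_m}) (C : R) :
  weakly_sidorenko B C -> (0 < omega_dir B)%N -> (t <= omega_dir B * k)%N ->
  (omega_dir B * k)%:R + 1 + C ^+ k * (t + k)%:R <= n%:R ->
  ramsey_prop F t n.
Proof.
move=> sidB p0 tk le_n.
have [B0 [U rU Udir]] := omega_dir_witness p0.
have C1 := weakly_sidorenko_ge1 sidB B0.
have tn : (t <= n)%N.
  rewrite -(ler_nat R); apply: le_trans le_n.
  have : (t%:R <= (omega_dir B * k)%:R :> R) by rewrite ler_nat.
  have : 0 <= C ^+ k * (t + k)%:R by rewrite mulr_ge0 ?exprn_ge0 //; lra.
  lra.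
apply/forallP => Red; apply/orP; apply: contrapT => /not_orP[noplane noblue].
have noplane' (S : 'M[F]_n) : \rank S = 2%N ->
     exists v : 'rV[F]_n, [/\ v != 0, (v <= S)%MS & <<v>>%MS \notin Red].
  move=> rS; have /existsPn/(_ S) := introN idP noplane.
  rewrite rS eqxx => /forallPn[v]; rewrite negb_imply => /andP[/andP[v0 vS] vR].
  by exists v.
have noblue' (S : 'M[F]_n) : \rank S = t ->
     exists v : 'rV[F]_n, [/\ v != 0, (v <= S)%MS & <<v>>%MS \in Red].
  move=> rS; have /existsPn/(_ S) := introN idP noblue.
  rewrite rS eqxx => /forallPn[v]; rewrite negb_imply negbK => /andP[/andP[v0 vS] vR].
  by exists v.
rewrite -rU in tk le_n.
have [A [W [rW dA dirA]]] :=
  iterated_translates sidB C1 B0 Udir (red_vectors_dense noblue' tn) le_n.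
have [b Ab] : exists b, b \in A.
  apply/card_gt0P; rewrite -(ltr_nat R); apply: lt_le_trans dA.
  by rewrite powR_gt0 // ltr0n ltnW ?card_finNzRing_gt1.
rewrite -rW in tk; have [S rS SW] := exists_submx_rank tk.
(* A red [w] in [S] would be a direction of the red vectors, by the constant line at [b], and so
   would also be blue. *)
have [w [w0 wS wR]] := noblue' S rS.
have [|b' b'w] := dirA b 0 _ w (submx_trans wS SW).
  by move=> l; rewrite scaler0 addr0.
by rewrite add0r in b'w; have := red_vectors_direction noplane' b'w w0; rewrite wR.
Qed.

Lemma Rq2_le (F : finFieldType) (t n : nat) : ramsey_prop F t n -> (Rq2 F t <= n)%N.
Proof.
by rewrite /Rq2; case: pselect => // h; case: ex_minnP => k _; apply.
Qed.

Unset Implicit Arguments.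

Theorem theorem6p3 (F : finFieldType) (m : nat) (B : {set 'rV[F]_m})
  (R : realType) (C : R) :
  weakly_sidorenko B C -> (0 < omega_dir B)%N ->
  exists K : R, exists T : nat, forall t : nat, (T <= t)%N ->
    (Rq2 F t)%:R <= K * t%:R * powR C (t%:R / (omega_dir B)%:R).
Proof.
move=> sidB p0.
have C1 := weakly_sidorenko_ge1 sidB (omega_dir_witness p0).1.
have nE := fun t n k => @ramsey_prop_of_dim F R m n t k B C sidB p0.
move: (omega_dir B) p0 nE => p p0 nE.
(* For [k = t %/ p + 1] one has [p * k <= (1 + p) * t] and [C ^+ k * (t + k) <= C * X * (3 * t)].
   The summand 3 collects the 1 of [1 + p], the additive 1 in the dimension bound, and the rounding
   of [z] down to an integer. *)
exists (p%:R + 3 + 3 * C), 1%N => t t1.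
set X := powR C _.
have X1 : 1 <= X.
  by rewrite -(powRr0 C) /X ler_powR // divr_ge0.
pose k := (t %/ p).+1.
have kp : (p * k <= t + p)%N by rewrite mulnS addnC leq_add2r mulnC leq_divM.
have kt : (k <= t.+1)%N by rewrite ltnS leq_div.
have Ck : C ^+ k <= C * X.
  rewrite exprS ler_pM2l; last lra.
  rewrite -powR_mulrn; last lra.
  by apply: ler_powR => //; rewrite ler_pdivlMr ?ltr0n // -natrM ler_nat leq_divM.
have t1R : 1 <= t%:R :> R by rewrite ler1n.
pose z := (p%:R + 3 + 3 * C) * t%:R * X.
have p0R : 0 <= p%:R :> R by [].
have tX : t%:R <= t%:R * X by rewrite ler_peMr //; lra.
have z0 : 0 <= z by rewrite !mulr_ge0 //; lra.
apply: (@le_trans _ _ (Num.truncn z)%:R); last by rewrite truncn_le.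
rewrite ler_nat; apply: Rq2_le; apply: (nE t _ k).
  by rewrite mulnC ltnW // ltn_ceil.
have := truncnS_gt z; rewrite -natr1.
have : C ^+ k * (t + k)%:R <= (C * X) * (3 * t%:R).
  apply: ler_pM => //; first by rewrite exprn_ge0 //; lra.
  by rewrite -natrM ler_nat; lia.
have : (p * k)%:R <= (1 + p%:R) * t%:R :> R.
  rewrite mulrDl mul1r -natrM -natrD ler_nat (leq_trans kp) // leq_add2l.
  by rewrite -{1}(muln1 p) leq_mul2l t1 orbT.
have : p%:R * t%:R <= p%:R * (t%:R * X) by rewrite ler_wpM2l.
have -> : z = p%:R * (t%:R * X) + 3 * (t%:R * X) + C * X * (3 * t%:R) by rewrite /z; ring.
rewrite mulrDl mul1r; move: (C ^+ k * _) (C * X * _) => u v.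
lra.
Qed.
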